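(* Let $Y=\sum_{\beta\in\mathcal Y}I_\beta$, where $(Q(\beta))_{\beta\in\mathcal Y}$ is a family of subsets of $\Gamma$. Suppose that there are $w_{\alpha,\beta}\in[0,\infty)$ and, for each $\beta\in\mathcal Y$, a family $(Q(\alpha))_{\alpha\in\mathcal X(\beta)}$ of subsets of $\Gamma$ such that $X=\sum_{\beta\in\mathcal Y}I_\beta X_\beta$, where $X_\beta=\sum_{\alpha\in\mathcal X(\beta)}w_{\alpha,\beta}I_{\alpha\setminus\beta}$ satisfies $$\max_{\beta\in\mathcal Y}\mathbb E X_\beta\ \le\ (1+\kappa)\min_{\beta\in\mathcal Y}\mathbb E X_\beta$$ for some $\kappa\in[0,\infty)$. For all $\varepsilon\in[0,1]$ and $\gamma\in[0,\infty)$ satisfying $\gamma\varepsilon\ge2\kappa$ and $\mathbf 1_{\{\mathbb E Y=0\}}\gamma\varepsilon\le2$ we have, with $c=1/2$, $$\mathbb P(X\le(1-\varepsilon)\mathbb E X)\ \ge\ c\,\gamma\varepsilon\;\mathbb P\bigl(Y\le(1-(1+\gamma)\varepsilon)\mathbb E Y\bigr).$$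
   Context: Setting: $\Gamma$ is a finite set with $|\Gamma|=N$, $\mathbf p=(p_i)_{i\in\Gamma}\in[0,1]^N$, and $\Gamma_{\mathbf p}\subseteq\Gamma$ is the random subset in which each $i\in\Gamma$ is included independently with probability $p_i$. The index sets $\mathcal Y$ (nonempty) and $\mathcal X(\beta)$, $\beta\in\mathcal Y$, are finite. For indices $\alpha,\beta$ with associated subsets $Q(\alpha),Q(\beta)\subseteq\Gamma$, $I_\beta=\mathbf 1_{\{Q(\beta)\subseteq\Gamma_{\mathbf p}\}}$ and $I_{\alpha\setminus\beta}=\mathbf 1_{\{Q(\alpha)\setminus Q(\beta)\subseteq\Gamma_{\mathbf p}\}}$. $\mathbf 1_{\{A\}}$ equals $1$ if $A$ holds and $0$ otherwise. *)

(* Defs.v *)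
From HB Require Import structures.
From mathcomp Require Import all_boot all_order all_algebra.
From mathcomp Require Import reals.

Set Implicit Arguments.
Unset Strict Implicit.
Unset Printing Implicit Defensive.

Import Order.TTheory GRing.Theory Num.Theory.
Local Open Scope ring_scope.

Section RandomSubset.
Variables (R : realType) (T : finType) (p : T -> R).

(* The law of the random subset: every i is included independently with       *)
(* probability p i.  Events and random variables are functions of its value.  *)
Definition rsub_law (S : {set T}) : R :=
  \prod_i (if i \in S then p i else 1 - p i).

Definition Prob (A : pred {set T}) : R := \sum_(S | A S) rsub_law S.

Definition Expect (f : {set T} -> R) : R := \sum_S rsub_law S * f S.

(* Case D = set0: total mass 1; in general: inclusion events are independent. *)
Lemma Prob_sub (D : {set T}) :
  Prob (fun S => D \subset S) = \prod_(i in D) p i.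
Proof.
pose F i b : R := if b then p i else if i \in D then 0 else 1 - p i.
transitivity (\prod_i (F i true + F i false)).
  rewrite bigA_distr /Prob big_mkcond /=; apply: eq_bigr => S _.
  case: ifPn => [/subsetP sDS | /subsetPn[i iD iS]].
    apply: eq_bigr => i _; rewrite /F; case: ifPn => // iS.
    by case: ifPn => // /sDS; rewrite (negPf iS).
  by rewrite (bigD1 i) //= (negPf iS) /F iD mul0r.
rewrite [RHS]big_mkcond /=; apply: eq_bigr => i _.
by rewrite /F; case: ifP => _; rewrite ?addr0 // addrC subrK.
Qed.

End RandomSubset.

(* Maximum and minimum of a finite family; i0 witnesses that the index set is *)
(* nonempty, and its choice does not affect the value.                        *)
Definition fmax (R : realType) (I : finType) (i0 : I) (f : I -> R) : R :=
  \big[Num.max/f i0]_i f i.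

Definition fmin (R : realType) (I : finType) (i0 : I) (f : I -> R) : R :=
  \big[Num.min/f i0]_i f i.

Section Variables.
Variables (R : realType) (T : finType) (B : finType) (Q : B -> {set T}).
(* The index sets of the inner sums, the sets attached to their elements and  *)
(* the weights may all depend on b.                                           *)
Variables (A : B -> finType) (q : forall b, A b -> {set T}).
Variable w : forall b, A b -> R.

Definition rvY (S : {set T}) : R := \sum_b (Q b \subset S)%:R.

Definition rvXb (b : B) (S : {set T}) : R :=
  \sum_(a : A b) w a * (q a :\: Q b \subset S)%:R.

Definition rvX (S : {set T}) : R := \sum_b (Q b \subset S)%:R * rvXb b S.

End Variables.

(* Main.v *)
(** Let [E] be the event [Y <= (1 - (1 + gamma) eps) EY], which is decreasing.
    Given [Q b \subset S], the variable [X_b] is increasing and independent of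
    [I_b], so a Harris-type inequality gives
    [E(I_b X_b 1_E) <= E(X_b) E(I_b 1_E)].  Summing over [b] and writing [M], [m]
    for the maximum and the minimum of the [E(X_b)], one obtains
    [E(X 1_E) <= M E(Y 1_E) <= (1 + kappa) m (1 - (1 + gamma) eps) EY P(E)], while
    [m EY <= EX].  Markov's inequality on [E] then bounds
    [P(E and X > (1 - eps) EX)] by [(1 - gamma eps / 2) P(E)]. *)
Require Import Defs.
From HB Require Import structures.
From mathcomp Require Import all_boot all_order all_algebra.
From mathcomp Require Import reals.
From mathcomp Require Import ring lra.

Set Implicit Arguments.
Unset Strict Implicit.
Unset Printing Implicit Defensive.

Import Order.TTheory GRing.Theory Num.Theory.
Local Open Scope ring_scope.

(** * Bounds for finite maxima and minima *)

Section FiniteExtrema.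
Variables (R : realType) (I : finType) (i0 : I) (f : I -> R).

Lemma le_fmax i : f i <= fmax i0 f.
Proof. by rewrite /fmax (bigD1 i) //= le_max lexx. Qed.

Lemma fmin_le i : fmin i0 f <= f i.
Proof. by rewrite /fmin (bigD1 i) //= ge_min lexx. Qed.

Lemma fmin_ge0 : (forall i, 0 <= f i) -> 0 <= fmin i0 f.
Proof.
move=> f0; rewrite /fmin; elim/big_ind: _ => // x y x0 y0.
by rewrite le_min x0.
Qed.

End FiniteExtrema.

(** * Expectation, correlation and Markov bounds under the product measure *)

Section ProductMeasure.
Variables (R : realType) (T : finType) (p : T -> R).
Hypothesis hp : forall i, 0 <= p i <= 1.
Implicit Types (S D : {set T}) (f g : {set T} -> R) (E : pred {set T}).

Lemma rsub_law_ge0 S : 0 <= rsub_law p S.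
Proof.
apply: prodr_ge0 => i _; have /andP[p0 p1] := hp i.
by case: ifP; rewrite ?subr_ge0.
Qed.

Lemma Prob_ge0 E : 0 <= Prob p E.
Proof. by apply: sumr_ge0 => S _; exact: rsub_law_ge0. Qed.

Lemma Prob_setT : Prob p xpredT = 1.
Proof.
have <- : \prod_(i in set0) p i = 1 by rewrite big_set0.
by rewrite -Prob_sub; apply: eq_bigl => S; rewrite sub0set.
Qed.

Lemma ProbE E : Prob p E = Expect p (fun S => (E S)%:R).
Proof.
rewrite /Prob /Expect big_mkcond; apply: eq_bigr => S _.
by case: (E S); rewrite ?mulr1 ?mulr0.
Qed.

Lemma ExpectZ c f : Expect p (fun S => c * f S) = c * Expect p f.
Proof. by rewrite mulr_sumr; apply: eq_bigr => S _; rewrite mulrCA. Qed.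

Lemma Expect_sum (J : finType) (F : J -> {set T} -> R) :
  Expect p (fun S => \sum_j F j S) = \sum_j Expect p (F j).
Proof.
rewrite /Expect exchange_big; apply: eq_bigr => S _.
by rewrite mulr_sumr.
Qed.

Lemma eq_Expect f g : f =1 g -> Expect p f = Expect p g.
Proof. by move=> fg; apply: eq_bigr => S _; rewrite fg. Qed.

Lemma le_Expect f g : (forall S, f S <= g S) -> Expect p f <= Expect p g.
Proof.
by move=> fg; apply: ler_sum => S _; rewrite ler_wpM2l ?rsub_law_ge0.
Qed.

Lemma Expect_ge0 f : (forall S, 0 <= f S) -> 0 <= Expect p f.
Proof. by move=> f0; apply: sumr_ge0 => S _; rewrite mulr_ge0 ?rsub_law_ge0. Qed.

Lemma Prob_le1 E : Prob p E <= 1.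
Proof.
rewrite -Prob_setT !ProbE; apply: le_Expect => S.
by rewrite ler_nat leq_b1.
Qed.

(** A vanishing sum of nonnegative terms has only zero terms, so each [S] with [f S > 0] carries no
    mass. *)
Lemma Expect_eq0_Prob f : (forall S, 0 <= f S) -> Expect p f = 0 ->
  Prob p (fun S => f S <= 0) = 1.
Proof.
move=> f0 Ef0; rewrite -Prob_setT /Prob big_mkcond; apply: eq_bigr => S _.
case: ifPn => //; rewrite -ltNge => fS.
have /(_ S isT)/eqP := psumr_eq0P (fun S _ => mulr_ge0 (rsub_law_ge0 S) (f0 S)) Ef0.
by rewrite mulf_eq0 (gt_eqF fS) orbF => /eqP ->.
Qed.

Lemma rsub_law_setU1 i S : i \notin S ->
  rsub_law p (i |: S) = p i * \prod_(j | j != i) (if j \in S then p j else 1 - p j).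
Proof.
move=> iS; rewrite /rsub_law (bigD1 i) //= setU11; congr (_ * _).
by apply: eq_bigr => j ji; rewrite !inE (negPf ji).
Qed.

Lemma rsub_law_notin i S : i \notin S ->
  rsub_law p S =
  (1 - p i) * \prod_(j | j != i) (if j \in S then p j else 1 - p j).
Proof. by move=> iS; rewrite /rsub_law (bigD1 i) //= (negPf iS). Qed.

(** Pairing each [S] that avoids [i] with [i |: S] isolates coordinate [i] while the others stay
    fixed. *)
Lemma Expect_split i f : Expect p f =
  \sum_(S : {set T} | i \notin S)
    (rsub_law p (i |: S) * f (i |: S) + rsub_law p S * f S).
Proof.
rewrite /Expect (bigID (fun S : {set T} => i \in S)) /= big_split /=.
congr (_ + _).
rewrite (reindex_onto (fun S => i |: S) (fun S => S :\ i)) /=; last first.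
  by move=> S iS; rewrite setD1K.
apply: eq_bigl => S; rewrite setU11 /=; apply/eqP/idP => [<-|iS].
  by rewrite !inE eqxx.
by rewrite setU1K.
Qed.

(** One-coordinate Harris inequality. With [r] the weight of the other coordinates, the two sides
    differ on the pair [S], [i |: S] by [p i * r * (1 - p i) * (g S - g (i |: S))]. *)
Lemma Expect_mem_le i g : (forall S, g (i |: S) <= g S) ->
  Expect p (fun S => (i \in S)%:R * g S) <= p i * Expect p g.
Proof.
move=> gi; rewrite !(Expect_split i) mulr_sumr; apply: ler_sum => S iS.
rewrite setU11 (negPf iS) mul0r mulr0 addr0 mul1r.
rewrite rsub_law_setU1 // [rsub_law p S](rsub_law_notin iS).
set r := \prod_(_ | _) _.
have r0 : 0 <= r.
  apply: prodr_ge0 => j _; have /andP[? ?] := hp j.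
  by case: ifP; rewrite ?subr_ge0.
have /andP[p0 p1] := hp i; have := gi S.
set x := g _; set y := g S => xy.
have : 0 <= p i * r * (1 - p i) * (y - x) by rewrite !mulr_ge0 ?subr_ge0.
by nra.
Qed.

(* Harris' inequality for an inclusion event [D \subset S] against a function
   that need only be decreasing in the coordinates of [D]. *)
Lemma Expect_subset_le D g :
    (forall i S, i \in D -> g (i |: S) <= g S) -> (forall S, 0 <= g S) ->
  Expect p (fun S => (D \subset S)%:R * g S) <= \prod_(i in D) p i * Expect p g.
Proof.
have [n] := ubnP #|D|; elim: n D => // n IHn D; rewrite ltnS => cD gD g0.
have [D0|[i iD]] := set_0Vmem D.
  rewrite D0 big_set0 mul1r; apply: le_Expect => S.
  by rewrite sub0set mul1r.
rewrite (big_setD1 i iD) /= -mulrA.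
have -> : Expect p (fun S => (D \subset S)%:R * g S) =
          Expect p (fun S => (i \in S)%:R * ((D :\ i \subset S)%:R * g S)).
  apply: eq_Expect => S.
  by rewrite mulrA -natrM mulnb -{1}(setD1K iD) subUset sub1set.
(* Adding [i] does not change whether [D :\ i] is contained in [S], so the product with [g] still
   decreases in coordinate [i]. *)
apply: (le_trans (@Expect_mem_le i (fun S => (D :\ i \subset S)%:R * g S) _)).
  move=> S; rewrite -subDset setDDl setUid.
  by rewrite ler_wpM2l ?ler0n ?gD.
have /andP[p0 _] := hp i; rewrite ler_wpM2l // IHn //.
  by move: cD; rewrite (cardsD1 i) iD.
by move=> j S /setD1P[_ /gD].
Qed.

Lemma Prob_split E E' :
  Prob p E = Prob p (fun S => E S && E' S) + Prob p (fun S => E S && ~~ E' S).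
Proof. exact: bigID. Qed.

Lemma le_Prob E E' : (forall S, E S -> E' S) -> Prob p E <= Prob p E'.
Proof.
move=> EE'; rewrite !ProbE; apply: le_Expect => S.
by rewrite ler_nat; case: (boolP (E S)) => // /EE' ->.
Qed.

(** Markov's inequality inside [E], for the strict excess [f S > t], the exact complement of the
    lower tail. *)
Lemma markov_on E f t : (forall S, 0 <= f S) -> 0 <= t ->
  t * Prob p (fun S => E S && ~~ (f S <= t)) <=
  Expect p (fun S => f S * (E S)%:R).
Proof.
move=> f0 t0; rewrite ProbE -ExpectZ; apply: le_Expect => S.
case: (E S); last by rewrite !mulr0.
by have [ft|/ltW tf] := leP (f S) t; rewrite ?mulr0 ?mulr1.
Qed.

End ProductMeasure.

(** * First moments of [X] and [Y], with and without restriction to a decreasing event *)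

Section WeightedCounts.
Variables (R : realType) (T : finType) (p : T -> R).
Hypothesis hp : forall i, 0 <= p i <= 1.
Variables (B : finType) (Q : B -> {set T}).
Variables (A : B -> finType) (q : forall b, A b -> {set T}).
Variable w : forall b, A b -> R.
Hypothesis hw : forall b (a : A b), 0 <= w a.

Local Notation X := (rvX Q q w).
Local Notation Xb := (rvXb Q q w).
Local Notation Y := (rvY R Q).

Lemma rvXb_ge0 b S : 0 <= Xb b S.
Proof. by apply: sumr_ge0 => a _; rewrite mulr_ge0. Qed.

Lemma rvX_ge0 S : 0 <= X S.
Proof. by apply: sumr_ge0 => b _; rewrite mulr_ge0 ?rvXb_ge0. Qed.

Lemma rvY_ge0 S : 0 <= Y S.
Proof. by apply: sumr_ge0. Qed.

Lemma rvY_setU1 i S : Y S <= Y (i |: S).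
Proof.
apply: ler_sum => b _; rewrite ler_nat; case: (boolP (Q b \subset S)) => // QS.
by rewrite (subset_trans QS) // subsetUr.
Qed.

Lemma Expect_rvXb b :
  Expect p (Xb b) = \sum_(a : A b) w a * \prod_(i in q a :\: Q b) p i.
Proof.
rewrite Expect_sum; apply: eq_bigr => a _.
by rewrite ExpectZ -Prob_sub ProbE.
Qed.

Lemma Expect_rvY : Expect p Y = \sum_b \prod_(i in Q b) p i.
Proof. by rewrite Expect_sum; apply: eq_bigr => b _; rewrite -ProbE Prob_sub. Qed.

Lemma Expect_rvX :
  Expect p X = \sum_b \prod_(i in Q b) p i * Expect p (Xb b).
Proof.
rewrite Expect_sum; apply: eq_bigr => b _; rewrite Expect_rvXb mulr_sumr.
under eq_Expect do rewrite mulr_sumr.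
rewrite Expect_sum; apply: eq_bigr => a _.
have -> : Expect p (fun S => (Q b \subset S)%:R *
                             (w a * (q a :\: Q b \subset S)%:R)) =
          w a * Prob p (fun S => Q b :|: (q a :\: Q b) \subset S).
  rewrite ProbE -ExpectZ; apply: eq_Expect => S.
  by rewrite mulrCA -natrM mulnb subUset.
rewrite Prob_sub mulrCA; congr (_ * _).
(* [Q b] and [q a :\: Q b] are disjoint, so the product over their union factors: this is the
   independence of [I_b] and [X_b]. *)
rewrite (big_setID (Q b)) /=; congr (_ * _); apply: eq_bigl => i.
  by rewrite !inE; case: (i \in Q b); rewrite ?andbF ?andbT.
by rewrite !inE; case: (i \in Q b); rewrite ?andbF ?andbT.
Qed.

(** The factor [I_b] is increasing, but it does not depend on coordinates outside [Q b]. Hence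
    [I_b * 1_E] is decreasing in those of [q a :\: Q b], which is all that [Expect_subset_le] asks
    for. *)
Lemma Expect_rvXb_on_le b (E : pred {set T}) :
    (forall i S, E (i |: S) -> E S) ->
  Expect p (fun S => (Q b \subset S)%:R * Xb b S * (E S)%:R) <=
  Expect p (Xb b) * Expect p (fun S => (Q b \subset S)%:R * (E S)%:R).
Proof.
move=> decE; rewrite Expect_rvXb mulr_suml.
under eq_Expect do rewrite mulr_sumr mulr_suml.
rewrite Expect_sum; apply: ler_sum => a _.
set g := fun S : {set T} => (Q b \subset S)%:R * (E S)%:R : R.
have -> : Expect p (fun S => (Q b \subset S)%:R *
              (w a * (q a :\: Q b \subset S)%:R) * (E S)%:R) =
          w a * Expect p (fun S => (q a :\: Q b \subset S)%:R * g S).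
  by rewrite -ExpectZ; apply: eq_Expect => S; rewrite /g; ring.
rewrite -mulrA ler_wpM2l //; apply: Expect_subset_le => // [i S|S].
  move=> /setDP[_ iQ]; rewrite /g -!natrM !mulnb ler_nat.
  have -> : (Q b \subset i |: S) = (Q b \subset S).
    by rewrite -subDset (setDidPl _) // disjoint_sym disjoints1.
  by case: (Q b \subset S) => //=; case: (boolP (E _)) => // /decE ->.
by rewrite /g mulr_ge0.
Qed.

Lemma Expect_rvX_on_le M (E : pred {set T}) :
    (forall b, Expect p (Xb b) <= M) -> (forall i S, E (i |: S) -> E S) ->
  Expect p (fun S => X S * (E S)%:R) <= M * Expect p (fun S => Y S * (E S)%:R).
Proof.
move=> hM decE.
under eq_Expect do rewrite mulr_suml.
under [in leRHS]eq_Expect do rewrite mulr_suml.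
rewrite !Expect_sum mulr_sumr; apply: ler_sum => b _.
apply: le_trans (Expect_rvXb_on_le b decE) _.
by rewrite ler_wpM2r // Expect_ge0 // => S; rewrite mulr_ge0.
Qed.

Lemma Expect_rvX_ge m : (forall b, m <= Expect p (Xb b)) ->
  m * Expect p Y <= Expect p X.
Proof.
move=> hm; rewrite Expect_rvX Expect_rvY mulr_sumr; apply: ler_sum => b _.
by rewrite mulrC ler_wpM2l // -Prob_sub Prob_ge0.
Qed.

Lemma Expect_rvX_le M : (forall b, Expect p (Xb b) <= M) ->
  Expect p X <= M * Expect p Y.
Proof.
move=> hM; rewrite Expect_rvX Expect_rvY mulr_sumr; apply: ler_sum => b _.
by rewrite [leRHS]mulrC ler_wpM2l // -Prob_sub Prob_ge0.
Qed.

End WeightedCounts.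

Theorem theorem18 (R : realType) (Gam : finType) (p : Gam -> R)
  (hp : forall i, 0 <= p i <= 1)
  (B : finType) (b0 : B) (Q : B -> {set Gam})
  (A : B -> finType) (q : forall b : B, A b -> {set Gam})
  (w : forall b : B, A b -> R)
  (hw : forall (b : B) (a : A b), 0 <= w b a)
  (kappa : R) (hkappa : 0 <= kappa)
  (hmaxmin : fmax b0 (fun b => Expect p (rvXb Q q w b)) <=
             (1 + kappa) * fmin b0 (fun b => Expect p (rvXb Q q w b)))
  (eps gamma : R) (heps : 0 <= eps <= 1) (hgamma : 0 <= gamma)
  (hge : 2 * kappa <= gamma * eps)
  (hY0 : (Expect p (rvY R Q) == 0)%:R * (gamma * eps) <= 2) :
  (1 / 2) * (gamma * eps) *
    Prob p (fun S => rvY R Q S <= (1 - (1 + gamma) * eps) * Expect p (rvY R Q))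
  <= Prob p (fun S => rvX Q q w S <= (1 - eps) * Expect p (rvX Q q w)).
Proof.
set x := gamma * eps in hge hY0 *.
set mu := fun b => _ in hmaxmin; set M := fmax b0 mu in hmaxmin.
set m := fmin b0 mu in hmaxmin.
set EY := Expect p (rvY R Q) in hY0 *; set EX := Expect p (rvX Q q w).
set t := (1 - (1 + gamma) * eps) * EY.
set E : pred {set Gam} := fun S => rvY R Q S <= t.
have /andP[e0 e1] := heps; have x0 : 0 <= x by rewrite mulr_ge0.
have tE : t = (1 - eps - x) * EY by rewrite /t /x; ring.
have P0 := Prob_ge0 hp E; have P1 := Prob_le1 hp E.
have EY0 : 0 <= EY by apply: Expect_ge0 => // S; exact: rvY_ge0.
have EX0 : 0 <= EX by apply: Expect_ge0 => // S; exact: rvX_ge0.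
have hM b : mu b <= M by exact: le_fmax.
have hm b : m <= mu b by exact: fmin_le.
have m0 : 0 <= m.
  by apply: fmin_ge0 => b; apply: Expect_ge0 => // S; exact: rvXb_ge0.
have [t0|t0] := ltP t 0.
  have -> : Prob p E = 0.
    apply: big1 => S ES; have := le_trans (rvY_ge0 R Q S) ES.
    by rewrite leNgt t0.
  by rewrite mulr0 Prob_ge0.
(* If [EX = 0], the right-hand probability is 1 and [x <= 2] suffices: it is [hY0] when [EY = 0],
   and otherwise [0 <= t] even gives [x <= 1 - eps]. *)
have [EX_eq0|EXn0] := eqVneq EX 0.
  have -> : Prob p (fun S => rvX Q q w S <= (1 - eps) * EX) = 1.
    by rewrite EX_eq0 mulr0; apply: Expect_eq0_Prob => // S; exact: rvX_ge0.
  have x2 : x <= 2.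
    have [EY_eq0|EYn0] := eqVneq EY 0; first by move: hY0; rewrite EY_eq0 eqxx mul1r.
    have EYp : 0 < EY by rewrite lt_def EYn0.
    by move: t0; rewrite tE pmulr_lge0 //; lra.
  by nra.
have EXp : 0 < EX by rewrite lt_def EXn0.
have EYp : 0 < EY.
  rewrite lt_def EY0 andbT; apply: contraNneq EXn0 => EY_eq0.
  have := Expect_rvX_le hp hM; rewrite -/EX -/EY EY_eq0 mulr0 => EXle.
  by rewrite eq_le EXle.
have u0 : 0 <= 1 - eps - x by move: t0; rewrite tE pmulr_lge0.
(* Markov's bound will be divided by [(1 - eps) * EX]; when this vanishes, [u0] forces [x = 0]. *)
have [e_eq1|en1] := eqVneq eps 1.
  have -> : x = 0 by lra.
  by rewrite mulr0 mul0r Prob_ge0.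
have e_lt1 : eps < 1 by rewrite lt_neqAle en1.
have decE i S : E (i |: S) -> E S by apply: le_trans; exact: rvY_setU1.
have YE : Expect p (fun S => rvY R Q S * (E S)%:R) <= t * Prob p E.
  rewrite ProbE -ExpectZ; apply: le_Expect => // S.
  by case: (boolP (E S)) => [|_]; rewrite ?mulr0 ?mulr1.
have M0 : 0 <= M by exact: le_trans m0 (le_trans (hm b0) (hM b0)).
have XE : Expect p (fun S => rvX Q q w S * (E S)%:R) <=
          (1 + kappa) * (1 - eps - x) * EX * Prob p E.
  apply: le_trans (Expect_rvX_on_le hp hw hM decE) _.
  apply: (le_trans (ler_wpM2l M0 YE)).
  rewrite mulrA ler_wpM2r // tE.
  apply: (@le_trans _ _ ((1 + kappa) * m * ((1 - eps - x) * EY))).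
    by rewrite ler_wpM2r // -tE.
  have -> : (1 + kappa) * m * ((1 - eps - x) * EY) =
            (1 + kappa) * (1 - eps - x) * (m * EY) by ring.
  by rewrite ler_wpM2l ?mulr_ge0 ?Expect_rvX_ge //; lra.
have te : 0 < (1 - eps) * EX by rewrite mulr_gt0 ?subr_gt0.
have := markov_on hp E (rvX_ge0 Q q hw) (ltW te).
set Pbad := Prob p _ => mark.
have split : Prob p E <= Prob p (fun S => rvX Q q w S <= (1 - eps) * EX) + Pbad.
  rewrite (Prob_split p E (fun S => rvX Q q w S <= (1 - eps) * EX)) lerD2r.
  by apply: le_Prob => // S /andP[].
(* Subtracting this from [split] leaves [x / 2 * Prob p E], whence the constant [1 / 2]. *)
suff bad : Pbad <= (1 - x / 2) * Prob p E by lra.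
rewrite -(ler_pM2l te); apply: le_trans mark (le_trans XE _).
rewrite [leRHS]mulrA ler_wpM2r // [leRHS]mulrAC ler_wpM2r //.
(* [(1 + x/2)(1 - eps - x) <= (1 + x/2)(1 - x)(1 - eps) <= (1 - x/2)(1 - eps)] *)
apply: (@le_trans _ _ ((1 + x / 2) * (1 - eps - x))).
  (* Here [hge] enters, as [kappa <= x / 2]. *)
  by rewrite ler_wpM2r //; lra.
(* The right side exceeds the left by exactly [x * eps + x * x / 2]. *)
have : 0 <= x * eps by rewrite mulr_ge0.
have : 0 <= x * x by rewrite mulr_ge0.
by nra.
Qed.
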